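(* Let $g\in C_B[0,\infty)$. Then there exists a positive constant $M_1$ such that for every $n\in\mathbb{N}$ and every $x\in[0,\infty)$, $$|\mathcal{RL}_{n}^{[\alpha]}(g;x)-g(x)|\leq M_1\,\omega_2\left(g;\sqrt{\gamma_n(x)}\right)+\omega\left(g;\eta_n(x)\right),$$ where $$\gamma_n(x)=\Phi_{n,2}^{\alpha}(x)+\left(\frac{1+2\phi+2x\beta_n}{2(\psi+\beta_n)}-x\right)^2,\qquad \eta_n(x)=\left|\frac{1+2\phi-2x\psi}{2(\psi+\beta_n)}\right|.$$
   Context: Standing data: $(\beta_n)_{n\in\mathbb N}$ is a strictly increasing sequence of real numbers with $\beta_1=1$ and $\beta_n\to\infty$; $\phi,\psi$ are fixed reals with $0\le\phi\le\psi$; $\alpha=\alpha_n\ge 0$ is a sequence of nonnegative reals (the index $n$ is suppressed). For $i\ge1$ put $x^{(i,-\alpha)}=\prod_{j=1}^{i}(x+(j-1)\alpha)$, and $x^{(0,-\alpha)}=1$. For $x\ge0$ and bounded locally integrable $g$ on $[0,\infty)$ (or, more generally, locally integrable $g$ for which the series converges absolutely) define $$\mathcal{RL}_{n}^{[\alpha]}(g;x)=\beta_n\sum_{i=0}^{\infty}(1+\beta_n\alpha)^{-x/\alpha}\left(\alpha+\frac{1}{\beta_n}\right)^{-i}\frac{x^{(i,-\alpha)}}{i!}\int_{i/\beta_n}^{(i+1)/\beta_n}g\left(\frac{\beta_n t+\phi}{\beta_n+\psi}\right)dt,$$ where for $\alpha=0$ the factor $(1+\beta_n\alpha)^{-x/\alpha}$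 is read as its limit $e^{-\beta_n x}$. Put $\Phi_{n,2}^{\alpha}(x)=\mathcal{RL}_{n}^{[\alpha]}((t-x)^2;x)$, the operator acting on the function of the variable $t$. $C_B[0,\infty)$ is the space of bounded continuous real functions on $[0,\infty)$. For $\delta\ge0$, $$\omega(g;\delta)=\sup_{0\le h\le\delta,\ x\ge0}|g(x+h)-g(x)|,\qquad \omega_2(g;\delta)=\sup_{0\le h\le\delta,\ x\ge0}|g(x+2h)-2g(x+h)+g(x)|.$$ *)

(* Defs.v *)
From mathcomp Require Import all_boot all_order all_algebra.
From mathcomp Require Import all_classical all_reals all_analysis.

Set Implicit Arguments.
Unset Strict Implicit.
Unset Printing Implicit Defensive.

Import Order.TTheory GRing.Theory Num.Theory.
Import numFieldNormedType.Exports.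

Local Open Scope classical_set_scope.
Local Open Scope ring_scope.

(* x^(i, -a) = x (x + a) ... (x + (i - 1) a); the empty product gives 1. *)
Definition rising (R : realType) (a x : R) (i : nat) : R :=
  \prod_(1 <= j < i.+1) (x + (j.-1)%:R * a).

(* (1 + b a)^(-x/a), read as its limit exp(- b x) when a = 0. *)
Definition prefactor (R : realType) (b a x : R) : R :=
  if a == 0 then expR (- (b * x)) else (1 + b * a) `^ (- (x / a)).

(* The operator RL_n^[alpha](g; x), with b = beta_n and a = alpha_n.  Only the
   values of g on [0, +oo[ matter (for b > 0 and 0 <= phi <= psi).  The
   integral is the Lebesgue integral; limn is the sum of the series whenever
   that series converges. *)
Definition RL (R : realType) (b a phi psi : R) (g : R -> R) (x : R) : R :=
  b * limn (series (fun i : nat =>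
    prefactor b a x * (a + b^-1) ^- i * (rising a x i / i`!%:R) *
    (\int[lebesgue_measure]_(t in `[i%:R / b, (i.+1)%:R / b])
       g ((b * t + phi) / (b + psi))))).

Definition Phi2 (R : realType) (b a phi psi x : R) : R :=
  RL b a phi psi (fun t => (t - x) ^+ 2) x.

(* A function on [0, +oo[ is the restriction of g : R -> R; continuity at 0 is
   therefore one-sided. *)
Definition CB (R : realType) (g : R -> R) : Prop :=
  {within `[0, +oo[, continuous g} /\
  (exists M : R, forall x : R, 0 <= x -> `|g x| <= M).

Definition omega (R : realType) (g : R -> R) (delta : R) : R :=
  sup [set y | exists h x : R,
    [/\ 0 <= h <= delta, 0 <= x & y = `|g (x + h) - g x|]].

Definition omega2 (R : realType) (g : R -> R) (delta : R) : R :=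
  sup [set y | exists h x : R,
    [/\ 0 <= h <= delta, 0 <= x &
        y = `|g (x + 2 * h) - 2 * g (x + h) + g x|]].

Definition gamma (R : realType) (b a phi psi x : R) : R :=
  Phi2 b a phi psi x +
  ((1 + 2 * phi + 2 * x * b) / (2 * (psi + b)) - x) ^+ 2.

Definition eta (R : realType) (b phi psi x : R) : R :=
  `|(1 + 2 * phi - 2 * x * psi) / (2 * (psi + b))|.

(* Main.v *)
(* The operator is an expectation: RL(g; x) = E g(T), where T is uniform on a
   cell whose index i is negative binomial (Poisson if a = 0) with mean b x, so
   that T has mean m = (1 + 2 phi + 2 x b) / (2 (psi + b)) and
   Phi2 = E (T - x)^2.  A bounded g whose second differences with steps at most
   delta are at most W satisfies, for some slope c,
     |g t - g m - c (t - m)| <= 23 W (1 + ((t - m) / delta)^2)   for all t >= 0.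
   Taking the expectation kills the linear term, and delta^2 = gamma gives
   |E g(T) - g m| <= 69 W because (t - m)^2 <= 2 (t - x)^2 + 2 (m - x)^2;
   finally |m - x| = eta. *)

Require Import Defs.
From mathcomp Require Import all_boot all_order all_algebra.
From mathcomp Require Import all_classical all_reals all_analysis.
From mathcomp Require Import ring lra.

Set Implicit Arguments.
Unset Strict Implicit.
Unset Printing Implicit Defensive.

Import Order.TTheory GRing.Theory Num.Theory.
Import numFieldNormedType.Exports.

Local Open Scope classical_set_scope.
Local Open Scope ring_scope.

(** * Deviation from a line under a bound on second differences *)

(** The first difference starts at most [4 * W] and gains at most [W] per step; summing [k] of these
    differences gives a quadratic bound. *)
Lemma second_difference_growth (R : realFieldType) (W : R) (u : nat -> R)
    (k : nat) :
    0 <= W -> `|u 0%N| <= 2 * W -> `|u 1%N| <= 2 * W ->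
    (forall j, (j.+2 <= k)%N -> `|u j.+2 - 2 * u j.+1 + u j| <= W) ->
  `|u k| <= (1 + k%:R) * (4 + k%:R) * W.
Proof.
move=> W0 u0 u1 hu.
have hd j : (j.+1 <= k)%N -> `|u j.+1 - u j| <= (4 + j%:R) * W.
  elim: j => [_|j IHj jk].
    by have := ler_normB (u 1%N) (u 0%N); lra.
  have -> : u j.+2 - u j.+1 = (u j.+2 - 2 * u j.+1 + u j) + (u j.+1 - u j).
    by ring.
  apply: le_trans (ler_normD _ _) _.
  by have := hu _ jk; have := IHj (ltnW jk); rewrite -natr1; lra.
suff hk j : (j <= k)%N -> `|u j| <= (1 + j%:R) * (4 + j%:R) * W by exact: hk.
elim: j => [_|j IHj jk]; first by lra.
have -> : u j.+1 = (u j.+1 - u j) + u j by ring.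
apply: le_trans (ler_normD _ _) _.
have := hd _ jk; have := IHj (ltnW jk); rewrite -natr1.
have := ler0n R j; nra.
Qed.

(* If S is the supremum of |f| on the interval, a second difference anchored at
   the nearer endpoint gives 2 |f t| <= W + S, hence S <= (W + S) / 2. *)
Lemma second_difference_interpolation (R : realType) (f : R -> R)
    (p d W K : R) :
    0 < d -> f p = 0 -> f (p + d) = 0 ->
    (forall t, p <= t <= p + d -> `|f t| <= K) ->
    (forall t h, p <= t -> 0 <= h -> t + 2 * h <= p + d ->
      `|f (t + 2 * h) - 2 * f (t + h) + f t| <= W) ->
  forall t, p <= t <= p + d -> `|f t| <= W.
Proof.
move=> d0 fp fpd fK fW.
pose E := [set y | exists2 t, p <= t <= p + d & y = `|f t|].
(* The crude bound [K] makes the supremum finite; the resulting estimate no longer depends on it. *)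
have supE : has_sup E.
  split; first by exists `|f p|, p => //; lra.
  by exists K => _ [t ht ->]; exact: fK.
have leE t : p <= t <= p + d -> `|f t| <= sup E.
  by move=> ht; apply: (ub_le_sup supE.2); exists t.
suff SW : sup E <= W by move=> t /leE /le_trans; apply.
suff : sup E <= (W + sup E) / 2 by lra.
apply: ge_sup; first exact: supE.1.
move=> _ [t ht ->]; have [tm|tm] := leP t (p + d / 2).
- have : `|f (p + 2 * (t - p))| <= sup E by apply: leE; lra.
  set z := f _ => hz; have H : `|z - 2 * f t| <= W.
    have := fW p (t - p); rewrite -/z fp addr0 (addrC p (t - p)) subrK.
    by apply; lra.
  have := ler_normB z (z - 2 * f t); rewrite opprB addrC subrK normrM.
  by rewrite ger0_norm//; lra.
- have : `|f (2 * t - p - d)| <= sup E by apply: leE; lra.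
  set z := f _ => hz; have H : `|- (2 * f t) + z| <= W.
    have := fW (2 * t - p - d) (p + d - t).
    have -> : 2 * t - p - d + 2 * (p + d - t) = p + d by ring.
    have -> : 2 * t - p - d + (p + d - t) = t by ring.
    by rewrite fpd sub0r; apply; lra.
  have := ler_normB z (- (2 * f t) + z); rewrite opprD opprK addrCA subrr addr0.
  by rewrite normrM ger0_norm//; lra.
Qed.

(** Subtracting a line leaves second differences unchanged. Once the remainder is controlled on two
    adjacent cells of length [d], a walk of step [d] from there reaches any [t], and its growth is
    quadratic in the number of steps. *)
Lemma quadratic_deviation (R : realType) (g : R -> R) (m d W K : R) :
    0 <= m -> 0 < d ->
    (forall t, 0 <= t -> `|g t| <= K) ->
    (forall t h, 0 <= t -> 0 <= h <= d ->
      `|g (t + 2 * h) - 2 * g (t + h) + g t| <= W) ->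
  exists c, forall t, 0 <= t ->
    `|g t - g m - c * (t - m)| <= 23 * W * (1 + ((t - m) / d) ^+ 2).
Proof.
move=> m0 d0 gK gW.
have W0 : 0 <= W.
  by apply: le_trans (gW m d m0 _) => //; rewrite (ltW d0) lexx.
(* The slope of the chord over [[m, m + d]]. The cell lies to the right of [m] because [m - d] may
   be negative. *)
pose c := (g (m + d) - g m) / d; exists c => t t0.
pose f t := g t - g m - c * (t - m).
rewrite -[leLHS]/`|f t|.
have fW s h : 0 <= s -> 0 <= h <= d ->
    `|f (s + 2 * h) - 2 * f (s + h) + f s| <= W.
  move=> s0 hd; apply: le_trans (gW s h s0 hd).
  by rewrite le_eqVlt; apply/orP; left; apply/eqP; congr `|_|; rewrite /f; ring.
have fm : f m = 0 by rewrite /f; ring.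
have fmd : f (m + d) = 0 by rewrite /f /c; field; lra.
have f1 s : m <= s <= m + d -> `|f s| <= W.
  apply: (@second_difference_interpolation _ _ _ _ _
    (K + K + `|c| * d)) => // [s1 hs1|s1 h ms1 h0 hs1].
    apply: le_trans (ler_normB _ _) _; apply: lerD.
      by apply: le_trans (ler_normB _ _) _; apply: lerD; apply: gK; lra.
    by rewrite normrM ler_wpM2l// ger0_norm; lra.
  by apply: fW; lra.
(* On the next cell the chord [l] of [f] is subtracted. One second difference with
   [f m = f (m + d) = 0] bounds [f (m + 2 * d)], hence [l], by [W]; interpolation bounds [f - l] by
   another [W]. *)
have f2 s : m <= s <= m + d -> `|f (s + d)| <= 2 * W.
  move=> hs; suff h : `|f (m + 2 * d)| <= W.
    pose l t := f (m + 2 * d) / d * (t - (m + d)).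
    have H : `|f (s + d) - l (s + d)| <= W.
      apply: (@second_difference_interpolation _ (fun t => f t - l t) (m + d) d
        _ (K + K + `|c| * (2 * d) + W)) => //; rewrite ?/l.
      - by rewrite fmd; ring.
      - have -> : m + d + d = m + 2 * d by ring.
        by field; lra.
      - move=> s1 hs1; apply: le_trans (ler_normB _ _) _; apply: lerD.
          apply: le_trans (ler_normB _ _) _; apply: lerD.
            by apply: le_trans (ler_normB _ _) _; apply: lerD; apply: gK; lra.
          by rewrite normrM ler_wpM2l// ger0_norm; lra.
        rewrite mulrAC -mulrA normrM -[leRHS]mulr1 ler_pM// ger0_norm.
          by rewrite ler_pdivrMr//; lra.
        by rewrite divr_ge0//; lra.
      - move=> s1 h1 hs1 h10 hs2.
        have -> : f (s1 + 2 * h1) - f (m + 2 * d) / d * (s1 + 2 * h1 - (m + d))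
          - 2 * (f (s1 + h1) - f (m + 2 * d) / d * (s1 + h1 - (m + d)))
          + (f s1 - f (m + 2 * d) / d * (s1 - (m + d)))
          = f (s1 + 2 * h1) - 2 * f (s1 + h1) + f s1 by ring.
        by apply: fW; lra.
      - by lra.
    rewrite -[f (s + d)](subrK (l (s + d))); apply: le_trans (ler_normD _ _) _.
    suff : `|l (s + d)| <= W by lra.
    rewrite /l mulrAC -mulrA normrM -[leRHS]mulr1 ler_pM// ger0_norm.
      by rewrite ler_pdivrMr//; lra.
    by rewrite divr_ge0//; lra.
  have := fW m d m0; rewrite fm fmd mulr0 subr0 addr0; apply.
  by rewrite (ltW d0) lexx.
(* Origin of 23: [(r + 3) * (r + 6) = r ^+ 2 + 9 * r + 18], and [9 * r] is at most
   [9 / 2 * (1 + r ^+ 2)], so the constant term is 22.5, rounded up. *)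
have quad_le (k r : R) : 0 <= k -> k <= r + 2 ->
    (1 + k) * (4 + k) <= 23 * (1 + r ^+ 2).
  by move=> k0 kr; have := sqr_ge0 (r - 1); rewrite !expr2; nra.
have [mt|tm] := leP m t.
(* Walk to the right, from [t - k * d] in the first cell to [t] in [k] steps. *)
- pose r := (t - m) / d; have r0 : 0 <= r by rewrite divr_ge0//; lra.
  pose k := Num.truncn r; have := truncn_itv r0; rewrite -/k => /andP[kr rk].
  have tE : t = m + r * d by rewrite /r mulfVK; lra.
  rewrite -/r.
  pose u j := f (t - k%:R * d + j%:R * d).
  have ht : m <= t - k%:R * d <= m + d.
    by rewrite -natr1 in rk; rewrite tE; nra.
  have <- : u k = f t by rewrite /u subrK.
  apply: (le_trans (second_difference_growth W0 _ _ _)).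
  - by rewrite /u mul0r addr0; have := f1 _ ht; lra.
  - by rewrite /u mul1r; apply: f2.
  - move=> j _; have := fW (t - k%:R * d + j%:R * d) d.
    rewrite /u -(natr1 j.+1) -(natr1 j).
    have -> : t - k%:R * d + j%:R * d + 2 * d
      = t - k%:R * d + (j%:R + 1 + 1) * d by ring.
    have -> : t - k%:R * d + j%:R * d + d
      = t - k%:R * d + (j%:R + 1) * d by ring.
    apply; last by rewrite (ltW d0) lexx.
    by have := ler0n R j; nra.
  - rewrite [leRHS]mulrAC ler_wpM2r//.
    by apply: quad_le => //; lra.
(* Walk to the left: [u 0] lies in the second cell, [u 1] in the first, and [t] is reached after
   [k + 2] steps, whence the [r + 2] in [quad_le]. No point of the walk is below [t], so all are
   nonnegative. *)
- pose r := (m - t) / d; have r0 : 0 <= r by rewrite divr_ge0//; lra.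
  pose k := Num.truncn r; have := truncn_itv r0; rewrite -/k => /andP[kr rk].
  have tE : t = m - r * d by rewrite /r mulfVK; lra.
  have -> : ((t - m) / d) ^+ 2 = r ^+ 2 by rewrite /r; ring.
  pose u j := f (t + k.+2%:R * d - j%:R * d).
  have ht : m <= t + k.+1%:R * d <= m + d.
    by rewrite -natr1 in rk *; rewrite tE; nra.
  have <- : u k.+2 = f t by rewrite /u addrK.
  apply: (le_trans (second_difference_growth W0 _ _ _)).
  - rewrite /u mul0r subr0 -natr1.
    have -> : t + (k.+1%:R + 1) * d = t + k.+1%:R * d + d by ring.
    exact: f2.
  - rewrite /u -natr1.
    have -> : t + (k.+1%:R + 1) * d - 1 * d = t + k.+1%:R * d by ring.
    by have := f1 _ ht; lra.
  - move=> j jk; have := fW (t + k.+2%:R * d - j.+2%:R * d) d; rewrite /u.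
    have -> : t + k.+2%:R * d - j.+2%:R * d + 2 * d
      = t + k.+2%:R * d - j%:R * d by rewrite -(natr1 j.+1) -(natr1 j); ring.
    have -> : t + k.+2%:R * d - j.+2%:R * d + d
      = t + k.+2%:R * d - j.+1%:R * d by rewrite -(natr1 j.+1); ring.
    set A := f _; set B := f _; set C := f _ => H.
    have -> : C - 2 * B + A = A - 2 * B + C by ring.
    apply: H; last by rewrite (ltW d0) lexx.
    by rewrite -addrA -mulrBl addr_ge0// mulr_ge0 ?(ltW d0)// subr_ge0 ler_nat.
  - rewrite [leRHS]mulrAC ler_wpM2r//.
    by apply: quad_le => //; rewrite -(natr1 k.+1) -(natr1 k); lra.
Qed.

(** * Sum and moments of the binomial series *)

(** Monotonicity turns the recurrence into [V n <= K + q * V n], hence a uniform bound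
    [K / (1 - q)]. *)
Lemma contracting_nondecreasing_is_cvgn (R : realType) (V : nat -> R)
    (K q : R) :
    q < 1 -> {homo V : m n / (m <= n)%N >-> m <= n} ->
    (forall n, V n.+1 <= K + q * V n) -> cvgn V.
Proof.
move=> q1 Vnd VS; apply: nondecreasing_is_cvgn => //.
exists (K / (1 - q)) => _ [n _ <-].
rewrite ler_pdivlMr; last by lra.
by have := VS n; have := Vnd _ _ (leqnSn n); lra.
Qed.

Lemma is_derive_ge0_le (R : realType) (f df : R -> R) (p q : R) :
    p <= q -> (forall s, p <= s <= q -> is_derive s 1 f (df s)) ->
    (forall s, p <= s <= q -> 0 <= df s) ->
  f p <= f q.
Proof.
move=> pq fdf df0.
have [||s + E] := MVT_segment pq (f := f) (df := df).
- by move=> s /subset_itv_oo_cc; rewrite /= in_itv/=; exact: fdf.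
- by apply: derivable_within_continuous => s; rewrite in_itv/= => /fdf.
- by rewrite in_itv/= => /df0 ?; rewrite -subr_ge0 E mulr_ge0// subr_ge0.
Qed.

(* The recurrence on [c] is the coefficient form of the differential equation
   (1 - a s) F' = x F, of which [P] is the reciprocal of a solution. *)
Section binomial_series.
Context {R : realType}.
Variables (a x y : R) (c : nat -> R).
Hypotheses (a0 : 0 <= a) (x0 : 0 <= x) (y0 : 0 <= y) (ay1 : a * y < 1).
Hypotheses (c_ge0 : forall i, 0 <= c i) (c0 : c 0%N = 1).
Hypothesis cS : forall i, i.+1%:R * c i.+1 = (x + i%:R * a) * c i.

Let F N : {poly R} := \sum_(i < N) c i *: 'X^i.

Let FE N s : (F N).[s] = \sum_(0 <= i < N) c i * s ^+ i.
Proof.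
rewrite /F horner_sum big_mkord; apply: eq_bigr => i _.
by rewrite hornerZ hornerXn.
Qed.

(** The recurrence on [c] cancels every coefficient except the top one, so the truncated series
    solves the differential equation up to a single boundary term. *)
Let F_deriv N s :
  (1 - a * s) * (F N)^`().[s] = x * (F N).[s] - N%:R * c N * s ^+ N.-1.
Proof.
elim: N => [|N IH]; first by rewrite /F big_ord0 deriv0 horner0; ring.
have FS : F N.+1 = F N + c N *: 'X^N by rewrite /F big_ord_recr.
rewrite FS derivD !hornerD mulrDr IH derivZ derivXn !hornerZ hornerMn !hornerXn.
rewrite cS -mulr_natl; case: N {IH FS} => [|N] /=; first by rewrite expr0; ring.
by rewrite exprS; ring.
Qed.

Variable P : R -> R.
Hypotheses (P0 : P 0 = 1) (P01 : forall s : R, 0 <= s <= y -> 0 < P s <= 1).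
Hypothesis dP : forall s : R, 0 <= s <= y ->
  is_derive s 1 P (- (x / (1 - a * s)) * P s).

Let as_gt0 (s : R) : 0 <= s <= y -> 0 < 1 - a * s.
Proof.
move=> /andP[_ sy]; rewrite subr_gt0; apply: le_lt_trans ay1.
exact: ler_wpM2l.
Qed.

Let dFP N (s : R) : 0 <= s <= y -> is_derive s 1 (fun s => (F N).[s] * P s)
  (- (P s / (1 - a * s)) * (N%:R * c N * s ^+ N.-1)).
Proof.
move=> sy; have := dP sy => dPs.
have as1 : 1 - a * s != 0 by rewrite gt_eqF// as_gt0.
apply: is_derive_eq; rewrite /GRing.scale/=.
have -> : N%:R * c N * s ^+ N.-1 =
    x * (F N).[s] - (1 - a * s) * (F N)^`().[s] by rewrite F_deriv; ring.
by field.
Qed.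

Let F0 N : (F N.+1).[0] = 1.
Proof.
rewrite FE big_nat_recl// big1 ?addr0 ?c0 ?expr0 ?mulr1// => i _.
by rewrite expr0n/= mulr0.
Qed.

(** By [dFP] the product is nonincreasing, and it starts at 1. *)
Let P_series_le1 N : (F N).[y] * P y <= 1.
Proof.
case: N => [|N]; first by rewrite /F big_ord0 horner0 mul0r.
have -> : 1 = (F N.+1).[0] * P 0 by rewrite F0 P0 mulr1.
rewrite -lerN2.
apply: (is_derive_ge0_le (f := fun s => - ((F N.+1).[s] * P s)) (df :=
  fun s => P s / (1 - a * s) * (N.+1%:R * c N.+1 * s ^+ N)) y0) => s sy.
  by apply: (is_derive_eq (is_deriveN (dFP N.+1 sy))); rewrite mulNr opprK.
rewrite mulr_ge0//.
  by rewrite divr_ge0// ltW// ?as_gt0//; case/andP: (P01 sy).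
by rewrite mulr_ge0 ?exprn_ge0 ?mulr_ge0//; case/andP: sy.
Qed.

(** Since [P s <= 1] and [(1 - a * s)^-1 <= k], the product decreases no faster than the monomial
    [G] increases; their sum [H] is nondecreasing. *)
Let P_series_ge N : 1 - c N.+1 * y ^+ N.+1 / (1 - a * y) <= (F N.+1).[y] * P y.
Proof.
pose k := (1 - a * y)^-1.
pose G : {poly R} := (c N.+1 * k) *: 'X^(N.+1).
pose H (s : R) := (F N.+1).[s] * P s + G.[s].
have H0 : H 0 = 1 by rewrite /H F0 P0 mulr1 /G hornerZ hornerXn exprS; ring.
have Hy : H y = (F N.+1).[y] * P y + c N.+1 * k * y ^+ N.+1.
  by rewrite /H /G hornerZ hornerXn.
rewrite lerBlDr mulrAC -/k -[leLHS]H0 -Hy.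
apply: (is_derive_ge0_le (f := H) (df :=
  fun s => (k - P s / (1 - a * s)) * (N.+1%:R * c N.+1 * s ^+ N)) y0) => s sy.
  apply: (is_derive_eq (is_deriveD (dFP N.+1 sy) (is_derive_poly G s))).
  by rewrite /G derivZ derivXn hornerZ hornerMn hornerXn -mulr_natl/=; ring.
rewrite mulr_ge0//.
  rewrite subr_ge0 ler_pdivrMr ?as_gt0//.
  case/andP: (P01 sy) => _ /le_trans; apply.
  rewrite /k ler_pdivlMl ?mulr1 ?as_gt0 ?y0 ?lexx//.
  by rewrite lerD2l lerN2 ler_wpM2l//; case/andP: sy.
by rewrite mulr_ge0 ?exprn_ge0 ?mulr_ge0//; case/andP: sy.
Qed.

Let u i := c i * y ^+ i.

Let u_ge0 i : 0 <= u i. Proof. by rewrite mulr_ge0// exprn_ge0. Qed.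

Let uS i : i.+1%:R * u i.+1 = y * (x + i%:R * a) * u i.
Proof. by rewrite /u mulrA cS exprS; ring. Qed.

Let nd_series (v : nat -> R) : (forall i, 0 <= v i) ->
  {homo series v : m n / (m <= n)%N >-> m <= n}.
Proof. by move=> v0; apply: nondecreasing_series => // i _; exact: v0. Qed.

(** The upper bound gives convergence of a nonnegative series, so its terms tend to 0; the defect in
    the lower bound then vanishes and the product is squeezed to 1. *)
Lemma cvg_binomial_series : series u @ \oo --> (P y)^-1.
Proof.
have Py0 : 0 < P y.
  by have /andP[] : 0 < P y <= 1 by apply: P01; rewrite y0 lexx.
have FP N : (F N).[y] = series u N by rewrite FE seriesEnat.
have cu : cvgn (series u).
  apply: nondecreasing_is_cvgn; first exact: nd_series.
  exists (P y)^-1 => _ [n _ <-]; rewrite -FP.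
  by rewrite -[leRHS]mul1r ler_pdivlMr.
have cu0 := cvg_series_cvg_0 cu.
suff H : series u n * P y @[n --> \oo] --> (1 : R).
  have -> : series u = fun n => series u n * P y * (P y)^-1.
    by apply/funext => n; rewrite mulfK// gt_eqF.
  by rewrite -[X in _ --> X]mul1r; apply: cvgM => //; exact: cvg_cst.
apply: (squeeze_cvgr (f := fun n => 1 - u n / (1 - a * y)) (h := fun=> 1)).
- near=> n.
  have n0 : (0 < n)%N by near: n; exact: nbhs_infty_gt.
  by rewrite -FP P_series_le1 andbT -(prednK n0) P_series_ge.
- have H : u n / (1 - a * y) @[n --> \oo] --> (0 : R).
    rewrite -[X in _ --> X](mul0r (1 - a * y)^-1).
    by apply: cvgM; [exact: cu0|exact: cvg_cst].
  rewrite -[X in _ --> X]subr0.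
  by apply: cvgB; [exact: cvg_cst|exact: H].
- exact: cvg_cst.
Unshelve. all: by end_near. Qed.

Let is_cvg_u : cvgn (series u).
Proof. by apply/cvg_ex; exists (P y)^-1; exact: cvg_binomial_series. Qed.

Let T i := i%:R * u i.

Let T_ge0 i : 0 <= T i. Proof. exact: mulr_ge0. Qed.

(** Shifting the index and applying the recurrence expresses the first moment through itself with
    ratio [a * y < 1]. This yields convergence, and in the limit a linear equation for the mean. *)
Let TS n : series T n.+1 = y * x * series u n + a * y * series T n.
Proof.
rewrite !seriesEnat/= big_nat_recl// {1}/T mul0r add0r.
rewrite !mulr_sumr -big_split; apply: eq_bigr => i _.
by rewrite /= /T uS; ring.
Qed.

Let is_cvg_T : cvgn (series T).
Proof.
apply: (contracting_nondecreasing_is_cvgn (K := y * x * (P y)^-1) ay1).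
  exact: nd_series.
move=> n; rewrite TS lerD2r ler_wpM2l ?mulr_ge0//.
rewrite -(cvg_lim _ cvg_binomial_series)//.
exact: (nondecreasing_cvgn_le (nd_series u_ge0) is_cvg_u).
Qed.

Lemma cvg_binomial_series_mean :
  series (fun i => i%:R * u i) @ \oo --> x * y / (1 - a * y) * (P y)^-1.
Proof.
have ay : 1 - a * y != 0 by rewrite subr_eq0 gt_eqF.
have H : series T n.+1 @[n --> \oo] -->
    y * x * (P y)^-1 + a * y * limn (series T).
  under eq_fun do rewrite TS.
  apply: cvgD; apply: cvgM; try exact: cvg_cst.
    exact: cvg_binomial_series.
  exact: is_cvg_T.
have : series T n.+1 @[n --> \oo] --> limn (series T).
  by rewrite (cvg_shiftS (series T)); exact: is_cvg_T.
move/(cvg_unique _ H) => E.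
suff -> : x * y / (1 - a * y) * (P y)^-1 = limn (series T) by exact: is_cvg_T.
apply: (mulfI ay); rewrite [RHS]mulrBl mul1r -{1}E//.
set p := (P y)^-1; by field.
Qed.

(** The same contraction, from [(i + 1) * (x + i * a) = x + i * (x + a) + i ^+ 2 * a]. Only
    convergence is claimed because [gamma] contains [Phi2] itself. *)
Lemma is_cvg_binomial_series_square :
  cvgn (series (fun i => i%:R ^+ 2 * u i)).
Proof.
pose V i := i%:R ^+ 2 * u i.
have VS n : series V n.+1 =
    y * x * series u n + y * (x + a) * series T n + a * y * series V n.
  rewrite !seriesEnat/= big_nat_recl// {1}/V expr0n mul0r add0r.
  rewrite !mulr_sumr -!big_split; apply: eq_bigr => i _.
  by rewrite /= /V expr2 -mulrA uS /T -natr1; ring.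
apply: (contracting_nondecreasing_is_cvgn (K := y * x * limn (series u) +
  y * (x + a) * limn (series T)) ay1).
  by apply: nd_series => i; rewrite mulr_ge0 ?sqr_ge0.
move=> n; rewrite -/V VS lerD2r lerD// ler_wpM2l ?mulr_ge0 ?addr_ge0//.
  exact: (nondecreasing_cvgn_le (nd_series u_ge0) is_cvg_u).
exact: (nondecreasing_cvgn_le (nd_series T_ge0) is_cvg_T).
Qed.

End binomial_series.

(** * The weights of the operator as a probability law *)

Lemma risingS (R : realType) (a x : R) i :
  rising a x i.+1 = rising a x i * (x + i%:R * a).
Proof. by rewrite /rising big_nat_recr. Qed.

Lemma rising_ge0 (R : realType) (a x : R) i :
  0 <= a -> 0 <= x -> 0 <= rising a x i.
Proof.
by move=> a0 x0; rewrite prodr_ge0// => j _; rewrite addr_ge0 ?mulr_ge0.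
Qed.

(** The solution is [exp(- x s)] if [a = 0] and [(1 - a s)^(x / a)] otherwise; the identity
    [1 - a y = (1 + b a)^-1] makes its value at [y] the prefactor. *)
Lemma prefactor_solution (R : realType) (b a x : R) (y := (a + b^-1)^-1) :
    0 < b -> 0 <= a -> 0 <= x ->
  exists P : R -> R, [/\ P 0 = 1, P y = prefactor b a x,
    forall s : R, 0 <= s <= y -> 0 < P s <= 1 &
    forall s : R, 0 <= s <= y -> is_derive s 1 P (- (x / (1 - a * s)) * P s)].
Proof.
move=> b0 a0 x0; rewrite /prefactor; have [aE|aN0] := eqVneq a 0.
  exists (fun s => expR (- x * s)); split.
  - by rewrite mulr0 expR0.
  - by rewrite /y aE add0r invrK mulNr mulrC.
  - move=> s /andP[s0 _]; rewrite expR_gt0 -[leRHS]expR0 ler_expR.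
    by rewrite mulNr oppr_le0 mulr_ge0.
  - move=> s _; have := is_derive_expR (- x * s) => dE.
    apply: is_derive_eq; rewrite aE /GRing.scale/=.
    by rewrite mul0r subr0 divr1; ring.
have {}a0 : 0 < a by rewrite lt_def aN0.
have bV0 : 0 < b^-1 by rewrite invr_gt0.
have yE : 1 - a * y = (1 + b * a)^-1.
  by rewrite /y; field; rewrite !gt_eqF ?addr_gt0 ?mulr_gt0.
have as0 (s : R) : 0 <= s <= y -> 0 < 1 - a * s.
  move=> /andP[_ sy]; apply: (@lt_le_trans _ _ (1 - a * y)).
    by rewrite yE invr_gt0 addr_gt0 ?mulr_gt0.
  by rewrite lerD2l lerN2 ler_wpM2l// ltW.
exists (fun s => expR (x / a * ln (1 - a * s))); split.
- by rewrite mulr0 subr0 ln1 mulr0 expR0.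
- rewrite yE lnV ?posrE ?addr_gt0 ?mulr_gt0// mulrN -mulNr.
  by rewrite /powR gt_eqF// addr_gt0 ?mulr_gt0.
- move=> s sy; rewrite expR_gt0 -[leRHS]expR0 ler_expR.
  rewrite mulr_ge0_le0//; first by rewrite divr_ge0// ltW.
  by apply: ln_le0; rewrite gerBl mulr_ge0 ?(ltW a0)//; case/andP: sy.
- move=> s sy; have := is_derive1_ln (as0 _ sy) => dL.
  have := is_derive_expR (x / a * ln (1 - a * s)) => dE.
  apply: is_derive_eq; rewrite /GRing.scale/=.
  by field; rewrite aN0 gt_eqF// as0.
Qed.

(** The mass at [i] of the negative binomial law, or of the Poisson law if [a = 0]. *)
Definition weight (R : realType) (b a x : R) (i : nat) : R :=
  prefactor b a x * (a + b^-1) ^- i * (rising a x i / i`!%:R).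

Section weight_moments.
Context {R : realType}.
Variables (b a x : R).
Hypotheses (b0 : 0 < b) (a0 : 0 <= a) (x0 : 0 <= x).

Let y := (a + b^-1)^-1.
Let c i := rising a x i / i`!%:R.

Let ab_gt0 : 0 < a + b^-1. Proof. by rewrite ltr_wpDl// invr_gt0. Qed.

Let y0 : 0 <= y. Proof. by rewrite invr_ge0 ltW. Qed.

Let ay1 : a * y < 1.
Proof. by rewrite ltr_pdivrMr// mul1r ltrDl invr_gt0. Qed.

Let c_ge0 i : 0 <= c i. Proof. by rewrite divr_ge0// rising_ge0. Qed.

Let c0 : c 0%N = 1.
Proof. by rewrite /c /rising big_geq// fact0 divr1. Qed.

Let cS i : i.+1%:R * c i.+1 = (x + i%:R * a) * c i.
Proof.
rewrite /c risingS factS natrM.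
have : i`!%:R != 0 :> R by rewrite pnatr_eq0 -lt0n fact_gt0.
have : i.+1%:R != 0 :> R by rewrite pnatr_eq0.
by move=> ? ?; field; apply/andP.
Qed.

Let weightE i : weight b a x i = prefactor b a x * (c i * y ^+ i).
Proof. by rewrite /weight -exprVn -/y -/(c i) -mulrA (mulrC (y ^+ i)). Qed.

Let series_weightE (v : nat -> R) :
  series (fun i => v i * weight b a x i) =
  fun n => prefactor b a x * series (fun i => v i * (c i * y ^+ i)) n.
Proof.
apply/funext => n; rewrite !seriesEnat/= mulr_sumr; apply: eq_bigr => i _.
by rewrite weightE mulrCA.
Qed.

Lemma prefactor_gt0 : 0 < prefactor b a x.
Proof.
have [P [_ <- + _]] := prefactor_solution b0 a0 x0.
by move=> /(_ y); rewrite y0 lexx => /(_ isT)/andP[].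
Qed.

Lemma weight_ge0 i : 0 <= weight b a x i.
Proof.
by rewrite weightE mulr_ge0 ?(ltW prefactor_gt0)// mulr_ge0 ?exprn_ge0.
Qed.

Lemma cvg_series_weight : series (weight b a x) @ \oo --> (1 : R).
Proof.
have [P [P0 Py P01 dP]] := prefactor_solution b0 a0 x0.
have -> : weight b a x = fun i => 1 * weight b a x i.
  by apply/funext => i; rewrite mul1r.
rewrite series_weightE -[X in _ --> X](mulfV (lt0r_neq0 prefactor_gt0)).
apply: cvgM; first exact: cvg_cst.
under [X in series X]eq_fun do rewrite mul1r.
rewrite -{1}Py.
exact: (cvg_binomial_series a0 y0 ay1 c_ge0 c0 cS P0 P01 dP).
Qed.

Lemma cvg_series_weight_mean :
  series (fun i => i%:R * weight b a x i) @ \oo --> b * x.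
Proof.
have [P [P0 Py P01 dP]] := prefactor_solution b0 a0 x0.
have -> : b * x = prefactor b a x * (x * y / (1 - a * y) * (P y)^-1).
  (* From this, [1 - a * y = y / b], which reduces [x * y / (1 - a * y)] to [b * x]. *)
  have yab : y * (a + b^-1) = 1 by rewrite mulVf// gt_eqF.
  have yN0 : y != 0 by apply/eqP => yE; move: yab; rewrite yE mul0r; lra.
  have -> : 1 - a * y = y / b by rewrite -yab; ring.
  have := lt0r_neq0 prefactor_gt0; rewrite Py => p0.
  by field; rewrite p0 yN0 gt_eqF.
rewrite series_weightE; apply: cvgM; first exact: cvg_cst.
exact: (cvg_binomial_series_mean a0 x0 y0 ay1 c_ge0 c0 cS P0 P01 dP).
Qed.

Lemma is_cvg_series_weight_square :
  cvgn (series (fun i => i%:R ^+ 2 * weight b a x i)).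
Proof.
have [P [P0 Py P01 dP]] := prefactor_solution b0 a0 x0.
rewrite series_weightE; apply: is_cvgM; first exact: is_cvg_cst.
exact: (is_cvg_binomial_series_square a0 x0 y0 ay1 c_ge0 c0 cS P0 P01 dP).
Qed.

End weight_moments.

(** * Averages over the cells *)

(** Meant for [g] continuous only within [[0, +oo[], precomposed with the affine map that sends each
    cell into that half-line. *)
Lemma within_continuous_comp_subset (U V W : topologicalType) (A : set U)
    (B : set V) (v : U -> V) (g : V -> W) :
    continuous v -> (forall t, A t -> B (v t)) ->
    {within B, continuous g} ->
  {within A, continuous g \o v}.
Proof.
move=> cv AB /subspace_continuousP cg; apply/subspace_continuousP => t At.
move=> P /(cg _ (AB _ At)) nP.
have vP : nbhs t [set s | B (v s) -> P (g (v s))] := cv t _ nP.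
change (nbhs t [set s | A s -> P (g (v s))]).
by apply: filterS vP => s /= BP As; apply: BP; exact: AB.
Qed.

Lemma Rintegral_deriv (R : realType) (Q : {poly R}) (p q : R) : p < q ->
  \int[lebesgue_measure]_(t in `[p, q]) (Q^`()).[t] = Q.[q] - Q.[p].
Proof.
move=> pq; rewrite /Rintegral (continuous_FTC2 (F := horner Q))//.
- by apply: continuous_subspaceT; exact: continuous_horner.
- split=> [t _||].
  + exact: derivable_horner.
  + by apply: cvg_at_right_filter; exact: continuous_horner.
  + by apply: cvg_at_left_filter; exact: continuous_horner.
- by move=> t _; rewrite derivE.
Qed.

Section cell_average.
Context {R : realType}.
Variables (b phi psi : R).
Hypotheses (b0 : 0 < b) (phi0 : 0 <= phi) (phipsi : phi <= psi).

Let v (t : R) := (b * t + phi) / (b + psi).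

Let bpsi0 : 0 < b + psi.
Proof. by rewrite ltr_pwDl// (le_trans phi0). Qed.

(** A cell has length [b^-1], so the factor [b] makes this a mean value. *)
Definition cell_average (g : R -> R) (i : nat) : R :=
  b * \int[lebesgue_measure]_(t in `[i%:R / b, i.+1%:R / b])
    g ((b * t + phi) / (b + psi)).

Let d := (b + psi)^-1.

Let d0 : d != 0. Proof. by rewrite invr_eq0 gt_eqF. Qed.

(** The change of variable [v] as a polynomial, so that powers are integrated by formal
    antiderivatives. *)
Let L : {poly R} := (b * d) *: 'X + (phi * d)%:P.

Let LE t : L.[t] = v t.
Proof. by rewrite /L hornerD hornerZ hornerX hornerC /v -/d; ring. Qed.

Let L_antideriv (r : R) n :
  ((n.+1%:R * (b * d))^-1 *: (L - r%:P) ^+ n.+1)^`() = (L - r%:P) ^+ n.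
Proof.
have k0 : n.+1%:R * (b * d) != 0.
  by rewrite mulf_neq0 ?pnatr_eq0// mulf_neq0 ?d0 ?gt_eqF.
rewrite derivZ deriv_exp/= derivB derivD derivZ derivX !derivC addr0 subr0.
by rewrite -scalerAl mul1r -[X in _ *: X]scaler_nat !scalerA -mulrA mulVf//
  scale1r.
Qed.

Let cell_lt i : i%:R / b < i.+1%:R / b.
Proof. by rewrite ltr_pM2r ?invr_gt0// ltr_nat. Qed.

Let v_ge0 i (t : R) : t \in `[i%:R / b, i.+1%:R / b] -> 0 <= v t.
Proof.
rewrite in_itv/= => /andP[it _].
have t0 : 0 <= t by apply: le_trans it; rewrite divr_ge0// ltW.
by rewrite divr_ge0 ?(ltW bpsi0)// addr_ge0// mulr_ge0// ltW.
Qed.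

Let cell_average_pow x n i :
  cell_average (fun u => (u - x) ^+ n) i = (n.+1%:R * d)^-1 *
    (((i%:R + 1 + phi) * d - x) ^+ n.+1 - ((i%:R + phi) * d - x) ^+ n.+1).
Proof.
have dQ t : (v t - x) ^+ n =
    (((n.+1%:R * (b * d))^-1 *: (L - x%:P) ^+ n.+1)^`()).[t].
  by rewrite L_antideriv horner_exp hornerD hornerN hornerC LE.
rewrite /cell_average; under eq_Rintegral do rewrite -/(v _) dQ.
rewrite Rintegral_deriv// !hornerZ !horner_exp !hornerD !hornerN !hornerC.
rewrite !hornerZ !hornerX -mulrBr [LHS]mulrA -(natr1 i).
congr (_ * (_ ^+ _ - _ ^+ _)).
- by field; rewrite d0 nat1r pnatr_eq0/= gt_eqF.
- by field; rewrite gt_eqF.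
- by field; rewrite gt_eqF.
Qed.

Lemma cell_average_linear i :
  cell_average id i = (i%:R + 2^-1 + phi) / (b + psi).
Proof.
have := cell_average_pow 0 1 i.
rewrite (_ : (fun _ => _) = id); last by apply/funext => u; rewrite subr0 expr1.
by rewrite -/d => ->; field.
Qed.

(** Squared bias plus variance: the last term is the variance of the uniform law on an interval of
    length [(b + psi)^-1]. *)
Lemma cell_average_square x i :
  cell_average (fun u => (u - x) ^+ 2) i =
  ((i%:R + 2^-1 + phi) / (b + psi) - x) ^+ 2 + (12 * (b + psi) ^+ 2)^-1.
Proof.
by rewrite cell_average_pow [X in _ = _ + X]invfM -exprVn -/d; field.
Qed.

Let cell_integrable (g : R -> R) i :
  {within `[0, +oo[, continuous g} ->
  lebesgue_measure.-integrable `[i%:R / b, i.+1%:R / b]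
    (EFin \o (fun t => g (v t))).
Proof.
move=> cg; apply: continuous_compact_integrable; first exact: segment_compact.
apply: (within_continuous_comp_subset _ _ cg).
- have -> : v = horner L by apply/funext => t; rewrite LE.
  exact: continuous_horner.
- by move=> t /v_ge0; rewrite /= in_itv/= andbT.
Qed.

Lemma cell_averageD (g h : R -> R) i :
    {within `[0, +oo[, continuous g} -> {within `[0, +oo[, continuous h} ->
  cell_average (fun u => g u + h u) i = cell_average g i + cell_average h i.
Proof.
by move=> cg ch; rewrite /cell_average RintegralD ?mulrDr//;
  exact: cell_integrable.
Qed.

Lemma cell_averageZ (g : R -> R) k i : {within `[0, +oo[, continuous g} ->
  cell_average (fun u => k * g u) i = k * cell_average g i.
Proof.
move=> cg; rewrite /cell_average mulrCA; congr (b * _).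
by rewrite -(RintegralZl k _ (cell_integrable i cg)).
Qed.

Lemma cell_average_cst k i : cell_average (fun=> k) i = k.
Proof.
pose Q : {poly R} := k *: 'X.
have QE (t : R) : Q^`().[t] = k by rewrite derivZ derivX !hornerE.
rewrite /cell_average.
under eq_Rintegral => t _ do rewrite -(QE t).
by rewrite Rintegral_deriv// !hornerE -(natr1 i)/=; field; rewrite gt_eqF.
Qed.

Lemma le_norm_cell_average (g h : R -> R) i :
    {within `[0, +oo[, continuous g} -> {within `[0, +oo[, continuous h} ->
    (forall u : R, 0 <= u -> `|g u| <= h u) ->
  `|cell_average g i| <= cell_average h i.
Proof.
move=> cg ch gh; rewrite /cell_average normrM (gtr0_norm b0).
rewrite ler_wpM2l ?(ltW b0)//.
have ig := cell_integrable i cg; have ih := cell_integrable i ch.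
apply: (le_trans (le_normr_Rintegral _ ig)) => //.
apply: le_Rintegral => //; last by move=> t /v_ge0; exact: gh.
exact: integrable_norm ig.
Qed.

(** Linearity turns each side into the average of one continuous function; positivity of the average
    then compares them. *)
Lemma cell_average_near_linear (g : R -> R) (p k K1 K2 x : R) i :
    {within `[0, +oo[, continuous g} ->
    (forall u : R, 0 <= u -> `|g u - p - k * u| <= K1 + K2 * (u - x) ^+ 2) ->
  `|cell_average g i - p - k * cell_average id i| <=
    K1 + K2 * cell_average (fun u => (u - x) ^+ 2) i.
Proof.
move=> cg gK.
have cP (Q : {poly R}) : {within `[0, +oo[, continuous (horner Q)}.
  by apply: continuous_subspaceT; exact: continuous_horner.
have c1 (r : R) : {within `[0, +oo[, continuous (fun _ : R => r)}.
  by apply: continuous_subspaceT; exact: cst_continuous.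
have cid : {within `[0, +oo[, continuous (id : R -> R)}.
  by apply: continuous_subspaceT => z; exact: cvg_id.
have ck : {within `[0, +oo[, continuous (fun u : R => - k * u)}.
  rewrite (_ : (fun _ => _) = horner (- k *: 'X))//.
  by apply/funext => u; rewrite hornerZ hornerX.
have csq : {within `[0, +oo[, continuous (fun u : R => (u - x) ^+ 2)}.
  rewrite (_ : (fun _ => _) = horner (('X - x%:P) ^+ 2))//.
  by apply/funext => u; rewrite !hornerE.
have ck2 : {within `[0, +oo[, continuous (fun u : R => K2 * (u - x) ^+ 2)}.
  rewrite (_ : (fun _ => _) = horner (K2 *: ('X - x%:P) ^+ 2))//.
  by apply/funext => u; rewrite !hornerE.
have cgp : {within `[0, +oo[, continuous (fun u : R => g u - p)}.
  exact: within_continuousD.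
have -> : K1 + K2 * cell_average (fun u => (u - x) ^+ 2) i =
    cell_average (fun u => K1 + K2 * (u - x) ^+ 2) i.
  by rewrite cell_averageD// cell_averageZ// cell_average_cst.
have -> : cell_average g i - p - k * cell_average id i =
    cell_average (fun u => g u - p + - k * u) i.
  by rewrite !cell_averageD// cell_averageZ// cell_average_cst mulNr.
apply: le_norm_cell_average => //.
- exact: within_continuousD.
- exact: within_continuousD.
- by move=> u /gK; rewrite mulNr.
Qed.

End cell_average.

(** * The operator on functions close to a line *)

Lemma cvg_seriesZl (R : realType) (f : nat -> R) (k l : R) :
  series f @ \oo --> l -> series (fun i => k * f i) @ \oo --> k * l.
Proof.
move=> fl; have -> : series (fun i => k * f i) = fun n => k * series f n.
  by apply/funext => n; rewrite !seriesEnat/= mulr_sumr.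
by apply: cvgM => //; exact: cvg_cst.
Qed.

Lemma cvg_series_linear (R : realType) (f g : nat -> R) (k l m : R) :
    series f @ \oo --> l -> series g @ \oo --> m ->
  series (fun i => k * f i + g i) @ \oo --> k * l + m.
Proof.
move=> fl gm.
have -> : (fun i => k * f i + g i) = (fun i => k * f i) + g by [].
by rewrite seriesD; apply: cvgD => //; exact: cvg_seriesZl.
Qed.

Section operator_bounds.
Context {R : realType}.
Variables (b a phi psi x : R).
Hypotheses (b0 : 0 < b) (a0 : 0 <= a) (phi0 : 0 <= phi) (phipsi : phi <= psi).
Hypothesis x0 : 0 <= x.

Local Notation w := (weight b a x).
Local Notation A := (cell_average b phi psi).
Local Notation sq := (fun u : R => (u - x) ^+ 2).

Let bpsi0 : 0 < b + psi.
Proof. by rewrite ltr_pwDl// (le_trans phi0). Qed.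

Let w_ge0 i : 0 <= w i. Proof. exact: weight_ge0. Qed.

Let cvg_w := cvg_series_weight b0 a0 x0.

Let cvg_w1 := cvg_series_weight_mean b0 a0 x0.

Let cvg_w2 := is_cvg_series_weight_square b0 a0 x0.

(** The outer factor [b] moves into each term and normalises the cell integral. *)
Lemma RL_eq_limit (g : R -> R) (l : R) :
  series (fun i => w i * A g i) @ \oo --> l -> RL b a phi psi g x = l.
Proof.
move=> gl; rewrite /RL.
set f := (X in series X).
have -> : series f = fun n => b^-1 * series (fun i => w i * A g i) n.
  apply/funext => n; rewrite !seriesEnat/= mulr_sumr; apply: eq_bigr => i _.
  by rewrite /f /cell_average /weight [RHS]mulrCA mulKf// gt_eqF.
have H : b^-1 * series (fun i => w i * A g i) n @[n --> \oo] --> b^-1 * l.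
  by apply: cvgM => //; exact: cvg_cst.
by rewrite (cvg_lim _ H)// mulVKf// gt_eqF.
Qed.

(** Each average equals [(d * i + r) ^+ 2 + d ^+ 2 / 12], so the series is a combination of the
    moments of order 0, 1 and 2. *)
Let cvg_Phi2 : series (fun i => w i * A sq i) @ \oo --> Phi2 b a phi psi x.
Proof.
suff [l cl] : exists l : R, series (fun i => w i * A sq i) @ \oo --> l.
  by rewrite /Phi2 (RL_eq_limit cl).
pose d := (b + psi)^-1; pose r := (2^-1 + phi) * d - x.
pose f i := d ^+ 2 * (i%:R ^+ 2 * w i) +
  (2 * d * r * (i%:R * w i) + ((r ^+ 2 + d ^+ 2 / 12) * w i)).
have -> : (fun i => w i * A sq i) = f.
  apply/funext => i; rewrite /f cell_average_square// [X in _ + X]invfM.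
  by rewrite -exprVn -/d /r; ring.
exists (d ^+ 2 * limn (series (fun i => i%:R ^+ 2 * w i)) +
  (2 * d * r * (b * x) + ((r ^+ 2 + d ^+ 2 / 12) * 1))).
have cvg_f1 := cvg_seriesZl (k := r ^+ 2 + d ^+ 2 / 12) cvg_w.
have cvg_f2 := cvg_series_linear (k := 2 * d * r) cvg_w1 cvg_f1.
exact: (cvg_series_linear cvg_w2 cvg_f2).
Qed.

(** The variance [e] within a cell bounds every average from below and the weights sum to 1.
    Strictness makes [gamma] positive, hence its square root an admissible step. *)
Lemma Phi2_gt0 : 0 < Phi2 b a phi psi x.
Proof.
pose e := (12 * (b + psi) ^+ 2)^-1.
have e0 : 0 < e by rewrite invr_gt0 mulr_gt0 ?exprn_gt0.
have cwe : series (fun i => e * w i) @ \oo --> e.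
  by rewrite -[X in _ --> X]mulr1; exact: cvg_seriesZl.
apply: lt_le_trans e0 _.
rewrite -(cvg_lim _ cwe)// -(cvg_lim _ cvg_Phi2)//.
apply: lim_series_le; [exact: cvgP cwe|exact: cvgP cvg_Phi2|move=> i].
by rewrite mulrC ler_wpM2l// cell_average_square// lerDr sqr_ge0.
Qed.

(** The expectation of a linear function is its value at the mean, and the error is at most the
    expectation of its bound. *)
Lemma RL_near_linear (g : R -> R) (p k K1 K2 : R) :
    {within `[0, +oo[, continuous g} ->
    (forall u : R, 0 <= u -> `|g u - p - k * u| <= K1 + K2 * (u - x) ^+ 2) ->
  `|RL b a phi psi g x -
    (p + k * ((1 + 2 * phi + 2 * x * b) / (2 * (psi + b))))| <=
    K1 + K2 * Phi2 b a phi psi x.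
Proof.
move=> cg gK; set m := (X in k * X).
pose B i := w i * (p + k * A id i); pose E i := w i * (K1 + K2 * A sq i).
have cB : series B @ \oo --> p + k * m.
  have -> : p + k * m =
      k / (b + psi) * (b * x) + (p + k * (2^-1 + phi) / (b + psi)) * 1.
    by rewrite /m; field; rewrite !gt_eqF// addrC.
  pose f i := k / (b + psi) * (i%:R * w i) +
    ((p + k * (2^-1 + phi) / (b + psi)) * w i).
  have -> : B = f.
    by apply/funext => i; rewrite /B /f cell_average_linear//; ring.
  exact: (cvg_series_linear cvg_w1 (cvg_seriesZl cvg_w)).
have cE : series E @ \oo --> K1 + K2 * Phi2 b a phi psi x.
  have -> : E = fun i => K2 * (w i * A sq i) + K1 * w i.
    by apply/funext => i; rewrite /E; ring.
  rewrite addrC -[X in _ + X]mulr1.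
  exact: (cvg_series_linear cvg_Phi2 (cvg_seriesZl cvg_w)).
(* Domination by the summable [E] gives absolute convergence of the deviations, and thereby
   convergence of the series in [RL], without which [limn] would not be its sum. *)
pose D i := w i * A g i - B i.
have DE i : `|D i| <= E i.
  rewrite /D /B /E -mulrBr normrM (ger0_norm (w_ge0 i)) ler_wpM2l//.
  by rewrite opprD addrA; exact: cell_average_near_linear.
have cnD : cvgn [normed series D].
  apply: (series_le_cvg _ _ DE) => //; last exact: cvgP cE.
  by move=> i; apply: le_trans (DE i).
have -> : RL b a phi psi g x = 1 * limn (series D) + (p + k * m).
  apply: RL_eq_limit.
  have -> : (fun i => w i * A g i) = fun i => 1 * D i + B i.
    by apply/funext => i; rewrite /D mul1r subrK.
  by apply: (cvg_series_linear _ cB); exact: normed_cvg.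
rewrite addrK mul1r; apply: le_trans (lim_series_norm cnD) _.
by rewrite -(cvg_lim _ cE)//; apply: lim_series_le => //; exact: cvgP cE.
Qed.

End operator_bounds.

(** * Moduli of continuity of a bounded function *)

Section moduli.
Context {R : realType}.
Variables (g : R -> R) (K delta : R).
Hypothesis gK : forall t, 0 <= t -> `|g t| <= K.

(** A real [sup] is an upper bound only for a set bounded above; the bound [K] on [g] ensures
    this. *)
Lemma le_omega t h : 0 <= t -> 0 <= h <= delta ->
  `|g (t + h) - g t| <= omega g delta.
Proof.
move=> t0 hd; apply: ub_le_sup; last by exists h, t.
exists (K + K) => _ [h1 [t1 [/andP[h10 _] t10 ->]]].
by apply: le_trans (ler_normB _ _) _; rewrite lerD// gK// addr_ge0.
Qed.

Lemma le_omega2 t h : 0 <= t -> 0 <= h <= delta ->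
  `|g (t + 2 * h) - 2 * g (t + h) + g t| <= omega2 g delta.
Proof.
move=> t0 hd; apply: ub_le_sup; last by exists h, t.
exists (K + 2 * K + K) => _ [h1 [t1 [/andP[h10 _] t10 ->]]].
apply: le_trans (ler_normD _ _) _; rewrite lerD ?gK//.
apply: le_trans (ler_normB _ _) _; rewrite lerD ?gK ?addr_ge0 ?mulr_ge0//.
by rewrite normrM ger0_norm// ler_wpM2l// gK// addr_ge0.
Qed.

End moduli.

Theorem theorem3p1 (R : realType) (beta alpha : nat -> R) (phi psi : R)
    (beta1 : beta 1%N = 1)
    (beta_incr : forall m n : nat, (1 <= m)%N -> (m < n)%N -> beta m < beta n)
    (beta_oo : beta n @[n --> \oo] --> +oo)
    (phi_ge0 : 0 <= phi) (phi_le_psi : phi <= psi)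
    (alpha_ge0 : forall n : nat, (1 <= n)%N -> 0 <= alpha n)
    (g : R -> R) (gCB : CB g) :
  exists M1 : R, 0 < M1 /\
    forall (n : nat) (x : R), (1 <= n)%N -> 0 <= x ->
      `|RL (beta n) (alpha n) phi psi g x - g x| <=
        M1 * omega2 g (Num.sqrt (gamma (beta n) (alpha n) phi psi x)) +
        omega g (eta (beta n) phi psi x).
Proof.
have [cg [K gK]] := gCB.
(* [69 = 23 * (1 + 2)]: the expectation of [(t - m) ^+ 2] is at most twice [gamma], the square of
   the step. *)
exists 69; split => // n x n1 x0.
have b0 : 0 < beta n.
  move: n1; rewrite leq_eqVlt => /predU1P[<-|n1]; first by rewrite beta1.
  by apply: lt_trans (beta_incr 1%N n _ n1) => //; rewrite beta1.
have a0 := alpha_ge0 n n1.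
move: (beta n) (alpha n) b0 a0 => b a b0 a0.
have psi0 : 0 <= psi by exact: le_trans phi_le_psi.
pose m := (1 + 2 * phi + 2 * x * b) / (2 * (psi + b)).
have m0 : 0 <= m.
  rewrite /m divr_ge0//; last by lra.
  by rewrite !addr_ge0// !mulr_ge0// ltW.
have mx : (1 + 2 * phi - 2 * x * psi) / (2 * (psi + b)) = m - x.
  by rewrite /m; field; lra.
set W := omega2 _ _; set G := gamma _ _ _ _ _ in W *.
have GE : G = Phi2 b a phi psi x + (m - x) ^+ 2 by [].
have P0 : 0 < Phi2 b a phi psi x by exact: Phi2_gt0.
have G0 : 0 < G by rewrite GE ltr_pwDl// sqr_ge0.
have sG : Num.sqrt G ^+ 2 = G by rewrite sqr_sqrtr// ltW.
have gW t h : 0 <= t -> 0 <= h <= Num.sqrt G ->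
    `|g (t + 2 * h) - 2 * g (t + h) + g t| <= W by exact: (le_omega2 gK).
have [c gc] := quadratic_deviation m0 (etrans (sqrtr_gt0 G) G0) gK gW.
have W0 : 0 <= W.
  by apply: le_trans (gW 0 0 _ _); rewrite ?lexx ?sqrtr_ge0.
have Hm : `|RL b a phi psi g x - g m| <= 69 * W.
  (* Intercept and slope of the line through [(m, g m)], in the form expected by
     [RL_near_linear]. *)
  have -> : g m = (g m - c * m) + c * m by ring.
  pose K1 := 23 * W * (1 + 2 * (m - x) ^+ 2 / G); pose K2 := 46 * W / G.
  have -> : 69 * W = K1 + K2 * Phi2 b a phi psi x.
    have -> : Phi2 b a phi psi x = G - (m - x) ^+ 2 by rewrite GE addrK.
    by rewrite /K1 /K2; field; rewrite gt_eqF.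
  apply: RL_near_linear => // u u0.
  have -> : g u - (g m - c * m) - c * u = g u - g m - c * (u - m) by ring.
  apply: le_trans (gc u u0) _; rewrite expr_div_n sG.
  have -> : K1 + K2 * (u - x) ^+ 2 =
      23 * W * (1 + (2 * (m - x) ^+ 2 + 2 * (u - x) ^+ 2) / G).
    by rewrite /K1 /K2; field; rewrite gt_eqF.
  rewrite ler_wpM2l ?mulr_ge0// lerD2l ler_pM2r ?invr_gt0//.
  (* The gap in [(u - m) ^+ 2 <= 2 * (m - x) ^+ 2 + 2 * (u - x) ^+ 2] is exactly this square. *)
  rewrite -subr_ge0; apply: le_trans (sqr_ge0 (u + m - 2 * x)) _.
  by rewrite le_eqVlt; apply/orP; left; apply/eqP; ring.
have Hx : `|g m - g x| <= omega g (eta b phi psi x).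
  (* [omega] uses forward increments only, so the smaller of [x] and [m] serves as base point. *)
  rewrite /eta mx; have [xm|mx'] := leP x m.
    have := @le_omega _ g K `|m - x| gK x (m - x) x0.
    rewrite (addrC x (m - x)) subrK; apply.
    by rewrite subr_ge0 xm ler_norm.
  have := @le_omega _ g K `|m - x| gK m (x - m) m0.
  rewrite (addrC m (x - m)) subrK [`|g x - _|]distrC; apply.
  by rewrite subr_ge0 (ltW mx') distrC ler_norm.
have -> : RL b a phi psi g x - g x =
    (RL b a phi psi g x - g m) + (g m - g x) by ring.
by apply: le_trans (ler_normD _ _) _; exact: lerD.
Qed.
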